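(* Let $\mathcal{L}=\{l_1, l_2, \dots, l_s\}$ be a set of $s$ nonnegative integers with $l_1<l_2<\dots<l_s$, and let $K=\{k_1,k_2,\dots,k_r\}$ be a set of positive integers with $k_i > s-r+l_1$ for every $1\le i\le r$. Suppose that $\mathcal{A}=\{A_1,A_2,\dots,A_m\}$ is a family of (distinct) subsets of $[n]=\{1,2,\dots,n\}$ such that $|A_i|\in K$ for every $1\le i\le m$ and $|A_i\cap A_j|\in\mathcal{L}$ for every pair $i\neq j$. Let $k=\max\{|A_j| : 1\le j\le m\}$. If $n\ge \binom{k^2}{l_1+1}s+l_1$, then \[ m\le \binom{n-l_1}{s}+\binom{n-l_1}{s-1}+\cdots+\binom{n-l_1}{s-r+1}. \] Moreover, if $n>\binom{k^2}{l_1+1}s+l_1$, equality holds only if there exists an $l_1$-subset $T$ of $[n]$ such that $T\subseteq A_j$ for every $j$.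
   Context: $\binom{a}{b}$ denotes the usual binomial coefficient, with $\binom{a}{b}=0$ if $b<0$. *)

(* Defs.v *)
From mathcomp Require Import all_boot all_order all_algebra.
Set Implicit Arguments.
Unset Strict Implicit.
Unset Printing Implicit Defensive.

(* By convention the coefficient vanishes when the lower index is negative. *)
Definition binz (a : nat) (b : int) : nat :=
  if b is Posz c then 'C(a, c) else 0.

(* Equals 0 on the empty family, where the maximum is otherwise undefined. *)
Definition max_member_size (n : nat) (F : {set {set 'I_n}}) : nat :=
  \max_(A in F) #|A|.

(* Main.v *)
(** If some [l1]-set [T] lies in every member, removing [T] and applying the
    Alon-Babai-Suzuki bound to the sets [A :\: T] gives the inequality. Otherwise,
    if [F] has two members, there is a set [M] with at most [k^2] points that meets every member in at
    least [l1 + 1] points, so [F] is covered by the links of the ['C(k^2, l1 + 1)]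
    subsets [T] of [M] with [l1 + 1] points. In each link the value [l1] is no
    longer an intersection size, hence the Alon-Babai-Suzuki bound applies with
    [s - 1] in place of [s], and
    [(n - l1) * 'C(n - l1 - 1, s - 1 - i) <= s * 'C(n - l1, s - i)] makes the total
    smaller than the claimed bound when [n] is large. *)
Require Import Defs.
From mathcomp Require Import all_boot all_order all_algebra.
From mathcomp Require Import zify.

Set Implicit Arguments.
Unset Strict Implicit.
Unset Printing Implicit Defensive.

Import GRing.Theory Num.Theory.

(** * Linear algebra: cardinality from a triangular matrix *)

(* The matrix of [h] on [I], ordered by [w], is triangular with nonzero diagonal,
   yet it factors through [M]. *)
Lemma triangular_card_le (R : fieldType) (U : finType) (I M : {set U})
    (h c e : U -> U -> R) (w : U -> nat) :
  (forall a b, a \in I -> h a b = \sum_(S in M) c a S * e S b)%R ->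
  (forall a, a \in I -> h a a != 0)%R ->
  (forall a b, a \in I -> b \in I -> a != b -> w b <= w a -> h a b = 0%R) ->
  #|I| <= #|M|.
Proof.
move=> hM hd ht; rewrite leqNgt; apply/negP => ltMI.
pose C : 'M[R]_(#|I|, #|M|) := (\matrix_(i, j) c (enum_val i) (enum_val j))%R.
have kn0 : kermx C != 0%R.
  rewrite kermx_eq0 /row_free neq_ltn.
  by apply/orP; left; apply: leq_ltn_trans (rank_leq_col _) ltMI.
have /rowV0Pn[v /sub_kermxP vC /rV0Pn[i0 vi0]] := kn0.
(* [v] is a linear dependence between the rows. In the column of the lightest index [i] of its
   support only the diagonal term survives, which is a contradiction. *)
pose i := [arg min_(j < i0 | v ord0 j != 0%R) w (enum_val j)].
have [vi imin] : v ord0 i != 0%R /\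
    forall j, v ord0 j != 0%R -> w (enum_val i) <= w (enum_val j).
  by rewrite /i; case: arg_minnP.
have sum0 : (\sum_j v ord0 j * h (enum_val j) (enum_val i) = 0)%R.
  under eq_bigr => j _.
    rewrite hM ?enum_valP // big_enum_val mulr_sumr.
    under eq_bigr => k _ do rewrite mulrA.
    over.
  rewrite exchange_big big1 // => k _.
  rewrite -mulr_suml [X in (X * _)%R](_ : _ = 0%R) ?mul0r //.
  have := congr1 (fun A : 'rV_#|M| => A ord0 k) vC; rewrite !mxE => vCk.
  by rewrite -[RHS]vCk; apply: eq_bigr => j _; rewrite mxE.
move: sum0; rewrite (bigD1 i) //= big1 ?addr0 => [/eqP|j ji].
  by rewrite mulf_eq0 (negbTE vi) (negbTE (hd _ (enum_valP i))).
have [->|vj] := eqVneq (v ord0 j) 0%R; first by rewrite mul0r.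
by rewrite ht ?mulr0 ?enum_valP ?imin // (inj_eq enum_val_inj).
Qed.

(** * Multilinear polynomials on the cube *)

Section MultilinearFunctions.

Variables (V : finType) (X : {set V}).
Implicit Types (A B S : {set V}) (f g : {set V} -> rat).

Definition small_subsets d := [set S : {set V} | (S \subset X) && (#|S| <= d)].

(* Multilinear polynomials in the variables of [X], of degree at most [d], read
   as functions on the cube: [S \subset B] is the value at [B] of the monomial
   with support [S]. *)
Definition multilinear d f := exists c : {set V} -> rat,
  forall B, f B = (\sum_(S in small_subsets d) c S * (S \subset B)%:R)%R.

Lemma eq_multilinear d f g : f =1 g -> multilinear d f -> multilinear d g.
Proof. by move=> fg [c hc]; exists c => B; rewrite -fg hc. Qed.

Lemma multilinear0 d : multilinear d (fun=> 0%R).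
Proof. by exists (fun=> 0%R) => B; rewrite big1 // => S _; rewrite mul0r. Qed.

Lemma multilinearD d f g :
  multilinear d f -> multilinear d g -> multilinear d (fun B => f B + g B)%R.
Proof.
move=> [c hc] [c' hc']; exists (fun S => c S + c' S)%R => B.
by rewrite hc hc' -big_split; apply: eq_bigr => S _; rewrite /= mulrDl.
Qed.

Lemma multilinearZ d f a : multilinear d f -> multilinear d (fun B => a * f B)%R.
Proof.
move=> [c hc]; exists (fun S => a * c S)%R => B.
by rewrite hc mulr_sumr; apply: eq_bigr => S _; rewrite mulrA.
Qed.

Lemma multilinear_sum d (I : finType) (P : pred I) (F : I -> {set V} -> rat) :
  (forall i, P i -> multilinear d (F i)) ->
  multilinear d (fun B => \sum_(i | P i) F i B)%R.
Proof.
move=> hF.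
suff H : forall r : seq I, multilinear d (fun B => \sum_(i <- r | P i) F i B)%R by exact: H.
elim=> [|i r IH].
  by apply: eq_multilinear (multilinear0 d) => B; rewrite big_nil.
case: (boolP (P i)) => Pi; last first.
  by apply: eq_multilinear IH => B; rewrite big_cons (negbTE Pi).
apply: eq_multilinear (multilinearD (hF i Pi) IH) => B.
by rewrite big_cons Pi.
Qed.

Lemma multilinear_monomial d S : S \subset X -> #|S| <= d ->
  multilinear d (fun B => (S \subset B)%:R)%R.
Proof.
move=> SX Sd; exists (fun S' => (S' == S)%:R)%R => B.
rewrite (bigD1 S) ?inE ?SX //= eqxx mul1r big1 ?addr0 // => S' /andP[_ /negbTE ->].
by rewrite mul0r.
Qed.

Lemma multilinearW d d' f : d <= d' -> multilinear d f -> multilinear d' f.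
Proof.
move=> dd' [c hc].
apply: (@eq_multilinear _ (fun B => \sum_(S in small_subsets d) c S * (S \subset B)%:R)%R) => [B|]; first by rewrite hc.
apply: multilinear_sum => S; rewrite inE => /andP[SX Sd].
exact/multilinearZ/multilinear_monomial/(leq_trans Sd).
Qed.

(** Expand [#|A :&: B|] as a sum of indicators of [x \in B] over [x] in [A]: on the cube, variable
    [x] times the monomial of [S] is the monomial of [x |: S]. *)
Lemma multilinearM_linear d f A (l : nat) : A \subset X -> multilinear d f ->
  multilinear d.+1 (fun B => f B * (#|A :&: B|%:R - l%:R))%R.
Proof.
move=> AX hf; have [c hc] := hf.
apply: (@eq_multilinear _ (fun B =>
   \sum_(S in small_subsets d)
     \sum_(x in A) c S * ((x |: S) \subset B)%:R + (- l%:R) * f B)%R).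
  move=> B; rewrite mulrBr mulNr [(l%:R * _)%R]mulrC; congr (_ - _)%R.
  rewrite hc mulr_suml; apply: eq_bigr => S _.
  rewrite -sum1_card natr_sum mulr_sumr (big_setID B) /= [X in (_ + X)%R]big1.
    rewrite addr0; apply: eq_bigr => x /setIP[_ xB].
    by rewrite mulr1 subUset sub1set xB.
  by move=> x /setDP[_ xB]; rewrite subUset sub1set (negbTE xB) mulr0.
apply: multilinearD; last by apply/multilinearZ/(multilinearW _ hf).
apply: multilinear_sum => S; rewrite inE => /andP[SX Sd].
apply: multilinear_sum => x xA; apply/multilinearZ/multilinear_monomial.
  by rewrite subUset sub1set SX (subsetP AX).
by rewrite cardsU1; case: (x \notin S) => //=; lia.
Qed.

Lemma multilinearM_prod d f A (s : seq nat) : A \subset X -> multilinear d f ->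
  multilinear (d + size s) (fun B => f B * \prod_(l <- s) (#|A :&: B|%:R - l%:R))%R.
Proof.
move=> AX hf; elim: s => [|l s IH] /=.
  by rewrite addn0; apply: eq_multilinear hf => B; rewrite big_nil mulr1.
rewrite addnS; apply: eq_multilinear (multilinearM_linear l AX IH) => B.
by rewrite big_cons -mulrA [((_ - l%:R) * _)%R]mulrC.
Qed.

End MultilinearFunctions.

(** * The Alon-Babai-Suzuki bound *)

Lemma prod_natrB_eq0 (s : seq nat) (a : nat) :
  (\prod_(l <- s) (a%:R - l%:R : rat) == 0)%R = (a \in s).
Proof.
elim: s => [|l s IH]; first by rewrite big_nil oner_eq0.
by rewrite big_cons mulf_eq0 IH subr_eq0 eqr_nat inE.
Qed.

Lemma binzB N s i : binz N (s%:Z - i%:Z)%R = if i <= s then 'C(N, s - i) else 0.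
Proof.
case: leqP => h; first by rewrite subzn.
by have -> : (s%:Z - i%:Z)%R = Negz (i - s).-1 by rewrite NegzE; lia.
Qed.

(* Alon, Babai and Suzuki: the functions [f_A], [A] in [F], and the products
   [g_I] of the monomials of degree at most [s - r] with [prod_(k in K) (|B| - k)]
   are linearly independent multilinear polynomials of degree at most [s]. *)
Lemma alon_babai_suzuki (V : finType) (X : {set V}) (s r : nat) (L K : seq nat)
    (F : {set {set V}}) :
  size L <= s -> size K <= r ->
  (forall x, x \in K -> s < x + r) ->
  (forall A, A \in F -> A \subset X) ->
  (forall A, A \in F -> #|A| \in K) ->
  (forall A B, A \in F -> B \in F -> A != B -> #|A :&: B| \in L) ->
  #|F| <= \sum_(i < r) binz #|X| (s%:Z - i%:Z)%R.
Proof.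
move=> sL sK Kbig FX FK FL.
(* The sum makes [small] empty when [s < r]; truncated subtraction would keep [set0]. *)
pose small := [set S : {set V} | (S \subset X) && (#|S| + r <= s)].
pose low := small_subsets X s.
(* Keeping only the factors with [l < #|A|] makes [f A A] nonzero. *)
pose f (A B : {set V}) : rat :=
  (\prod_(l <- [seq l <- L | (l < #|A|)%N]) (#|A :&: B|%:R - l%:R))%R.
pose g (I B : {set V}) : rat :=
  ((I \subset B)%:R * \prod_(l <- K) (#|X :&: B|%:R - l%:R))%R.
pose h A := if A \in F then f A else g A.
have dis A : A \in F -> A \notin small.
  by move=> AF; rewrite inE negb_and -ltnNge Kbig ?FK ?orbT.
have hlow a : a \in F :|: small -> multilinear X s (h a).
  rewrite inE /h; case: ifP => [aF _ | _ /=]; last first.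
    rewrite inE => /andP[aX aS].
    apply: (@multilinearW _ _ (#|a| + size K)); first by lia.
    exact/multilinearM_prod/multilinear_monomial.
  have m1 : multilinear X 0 (fun=> 1%R).
    apply: eq_multilinear (multilinear_monomial (sub0set X) _) => [B|].
      by rewrite sub0set.
    by rewrite cards0.
  apply: (@multilinearW _ _ (0 + size [seq l <- L | l < #|a|])).
    by rewrite size_filter (leq_trans (count_size _ _)).
  by apply: eq_multilinear (multilinearM_prod _ (FX _ aF) m1) => B; rewrite mul1r.
have [c hc] : exists c : {set V} -> {set V} -> rat, forall a b, a \in F :|: small ->
    (h a b = \sum_(S in low) c a S * (S \subset b)%:R)%R.
  (* Coefficients are taken as finite functions and the property as a boolean, so that [xchoose]
     selects them for all [a] at once. *)
  have cE a : exists c : {ffun {set V} -> rat}, (a \in F :|: small) ==>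
      [forall b, h a b == \sum_(S in low) c S * (S \subset b)%:R]%R.
    case: (boolP (a \in F :|: small)) => [/hlow [c hc] | _]; last by exists [ffun=> 0%R].
    exists (finfun c); apply/forallP => b; apply/eqP; rewrite hc.
    by apply: eq_bigr => S _; rewrite ffunE.
  exists (fun a S => (xchoose (cE a) : {ffun {set V} -> rat}) S) => a b aI.
  by have /implyP/(_ aI)/forallP/(_ b)/eqP := xchooseP (cE a).
(* Members of [F] come first, by size, then the small sets: [g] vanishes on [F], whereas [f] need
   not vanish on [small]. *)
pose w (A : {set V}) := if A \in F then #|A| else #|V| + #|A|.+1.
have Ile : #|F :|: small| <= #|low|.
  apply: (triangular_card_le (w := w) hc).
    move=> a; rewrite inE /h; case: ifP => [aF _|_ /=].
      by rewrite /f setIid prod_natrB_eq0 mem_filter ltnn.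
    rewrite inE /g subxx mul1r => /andP[aX aS]; rewrite prod_natrB_eq0.
    rewrite (setIidPr aX); apply/negP => /Kbig; lia.
  move=> a b; rewrite !inE /h /w; have [aF _ | aF /= aS] := boolP (a \in F).
    case: ifP => [bF _ ab ba|_ _ _]; last by have := subset_leq_card (subsetT a); rewrite cardsT; lia.
    apply/eqP; rewrite /f prod_natrB_eq0 mem_filter FL // andbT.
    apply: proper_card; rewrite properEneq subsetIl andbT.
    apply/eqP => /setIidPl asb; move: ab; rewrite eqEcard asb ba //.
  case: ifP => [bF _ _ _ | _ /= bS ab ba].
    apply/eqP; rewrite /g mulf_eq0 prod_natrB_eq0 (setIidPr (FX _ bF)) FK ?orbT //.
  rewrite /g; case: (boolP (a \subset b)) => [asb|_]; last by rewrite mul0r.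
  by move: ab; rewrite eqEcard asb /=; lia.
(* Sizes up to [s - r] are counted by [small] on both sides and cancel; the layers of size [s - i]
   with [i < r] give the bound. *)
have lowE : low \subset small :|: \bigcup_(i < r) [set S : {set V} | (S \subset X) & (#|S| + i == s)].
  apply/subsetP => S; rewrite !inE => /andP[SX Ss]; rewrite SX /=.
  have [//|h'] := leqP (#|S| + r) s; apply/bigcupP.
  have ir : s - #|S| < r by lia.
  by exists (Ordinal ir) => //; rewrite inE SX /= subnKC.
have disj : #|F :|: small| = #|F| + #|small|.
  rewrite cardsU (_ : F :&: small = set0) ?cards0 ?subn0 //.
  by apply/setP => A; rewrite [RHS]inE inE; case: (boolP (A \in F)) => // /dis /negbTE.
have bc : #|\bigcup_(i < r) [set S : {set V} | (S \subset X) & (#|S| + i == s)]|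
    <= \sum_(i < r) binz #|X| (s%:Z - i%:Z)%R.
  elim/big_ind2: _ => [|m A n B mA nB|i _]; first by rewrite cards0.
    by rewrite (leq_trans (leq_card_setU _ _)) // leq_add.
  rewrite binzB; case: (leqP i s) => is_.
    rewrite -cards_draws subset_leq_card //; apply/subsetP => S; rewrite !inE.
    by move=> /andP[-> /=]; lia.
  rewrite leqn0 cards_eq0; apply/eqP/setP => S; rewrite !inE.
  by apply/negbTE; lia.
have := leq_trans Ile (leq_trans (subset_leq_card lowE) (leq_card_setU _ _)).
lia.
Qed.

(** Deleting [T] is injective on supersets of [T] and lowers every size and intersection size by
    [#|T|]. *)
Lemma alon_babai_suzuki_link (V : finType) (T : {set V}) (s r : nat) (L K : seq nat)
    (F : {set {set V}}) :
  size L <= s -> size K <= r ->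
  (forall x, x \in K -> s + #|T| < x + r) ->
  (forall A, A \in F -> T \subset A) ->
  (forall A, A \in F -> #|A| \in K) ->
  (forall A B, A \in F -> B \in F -> A != B -> #|A :&: B| \in L) ->
  #|F| <= \sum_(i < r) binz (#|V| - #|T|) (s%:Z - i%:Z)%R.
Proof.
move=> sL sK Kbig FT FK FL.
have inj : {in F &, injective (fun A => A :\: T)}.
  move=> A B AF BF E; rewrite -(setID A T) -(setID B T) E.
  by rewrite (setIidPr (FT _ AF)) (setIidPr (FT _ BF)).
rewrite -(card_in_imset inj).
rewrite (_ : #|V| - #|T| = #|~: T|); last by rewrite [RHS]cardsCs setCK.
have sub (B : {set V}) : T \subset B -> #|B :\: T| = #|B| - #|T|.
  by move=> TB; rewrite cardsD (setIidPr TB).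
apply: (@alon_babai_suzuki _ (~: T) s r (map (subn^~ #|T|) L) (map (subn^~ #|T|) K)).
- by rewrite size_map.
- by rewrite size_map.
- by move=> _ /mapP[x /Kbig xK ->]; lia.
- by move=> _ /imsetP[A AF ->]; rewrite setDE subsetIr.
- by move=> _ /imsetP[A AF ->]; rewrite sub ?FT //; apply: map_f; apply: FK.
- move=> _ _ /imsetP[A AF ->] /imsetP[B BF ->] AB.
  rewrite -setDIl sub ?subsetI ?FT //; apply: map_f; apply: FL => //.
  by apply: contraNneq AB => ->.
Qed.

(** * Small covers, links and a binomial comparison *)

(* Fix [A1] in [F] and for each [x] in [A1] take, if possible, a member [b x] of
   [F] avoiding [x]. A set [A] meeting [A1] in an [l]-set [T] meets the member
   [b x], for some [x] in [T], in a point outside of [A1]. *)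
Lemma small_cover (V : finType) (F : {set {set V}}) (l k : nat) :
  1 < #|F| -> (forall A, A \in F -> #|A| <= k) ->
  (forall A B, A \in F -> B \in F -> A != B -> l <= #|A :&: B|) ->
  (forall T : {set V}, #|T| = l -> exists2 A, A \in F & ~~ (T \subset A)) ->
  exists2 M : {set V}, #|M| <= k ^ 2 & forall A, A \in F -> l < #|A :&: M|.
Proof.
move=> F1 Fk Fl noT.
have [A1 A1F] : exists A1, A1 \in F by apply/card_gt0P; lia.
have l_gt0 : 0 < l.
  rewrite lt0n; apply/eqP => l0.
  by have [|A _] := noT set0; rewrite ?cards0 ?sub0set.
have Fgt A : A \in F -> l < #|A|.
  move=> AF; have [B BF BA] : exists2 B, B \in F & B != A.
    have /card_gt0P[B] : 0 < #|F :\ A| by rewrite (cardsD1 A) AF in F1.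
    by rewrite !inE => /andP[]; exists B.
  rewrite ltn_neqAle (leq_trans (Fl _ _ BF AF BA)) ?subset_leq_card ?subsetIr // andbT.
  (* A member with exactly [l] points would lie in every other member, against [noT]. *)
  apply/eqP => lA; have [C CF /negP []] := noT A (esym lA).
  have [->//|CA] := eqVneq C A.
  by apply/setIidPr/eqP; rewrite eqEcard subsetIr -lA Fl.
(* The default [A1] keeps [b x] in [F] and contributes no point outside [A1]. *)
pose b x := odflt A1 [pick B in F | x \notin B].
have bF x : b x \in F by rewrite /b; case: pickP => //= B /andP[].
have bx x B : B \in F -> x \notin B -> x \notin b x.
  move=> BF xB; rewrite /b; case: pickP => [B' /andP[]//|/(_ B)].
  by rewrite BF xB.
exists (A1 :|: \bigcup_(x in A1) (b x :\: A1)).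
  (* Since [l > 0], each [b x] meets [A1] and adds at most [k.-1] points, so the total is at most
     [k + k * k.-1 = k ^ 2]. *)
  have : #|\bigcup_(x in A1) (b x :\: A1)| <= \sum_(x in A1) k.-1.
    elim/big_ind2: _ => [|m A n B mA nB|x xA1]; first by rewrite cards0.
      by rewrite (leq_trans (leq_card_setU _ _)) // leq_add.
    have [->|bA] := eqVneq (b x) A1; first by rewrite setDv cards0.
    rewrite cardsD; have := Fl _ _ (bF x) A1F bA; have := Fk _ (bF x); lia.
  rewrite sum_nat_const => leU.
  apply: leq_trans (leq_card_setU _ _) (leq_trans (leq_add (leqnn _) leU) _).
  have k_gt0 : 0 < k by apply: leq_trans (Fk _ A1F); apply: leq_ltn_trans (Fgt _ A1F).
  by rewrite -mulnS prednK // -mulnn leq_mul2r Fk ?orbT.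
move=> A AF; set M := _ :|: _.
have [AA1|nAA1] := eqVneq A A1.
  by rewrite (setIidPl _) ?Fgt // AA1 subsetUl.
have := Fl _ _ AF A1F nAA1; rewrite leq_eqVlt => /orP[/eqP AA1l|AA1l]; last first.
  by apply: leq_trans AA1l _; rewrite subset_leq_card // setIS // subsetUl.
have [B BF /subsetPn[x]] := noT _ (esym AA1l).
move=> /setIP[xA xA1] xB; have xb := bx _ _ BF xB.
have Ab : A != b x by apply: contraNneq xb => <-.
rewrite [X in X < _]AA1l; apply: proper_card; apply/properP; split.
  by rewrite setIS // subsetUl.
(* The left side has at least [l] points, the right side only [l - 1]. As [x] is not in [b x], the
   extra point [y] lies outside [A1]. *)
have /subsetPn[y /setIP[yA yb] yA1] : ~~ (A :&: b x \subset (A :&: A1) :\ x).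
  apply/negP => /subset_leq_card; have := Fl _ _ AF (bF x) Ab.
  by have := cardsD1 x (A :&: A1); rewrite inE xA xA1 -AA1l; lia.
have yx : y != x by apply: contraNneq xb => yx; rewrite -{1}yx.
move: yA1; rewrite !inE yx yA /= => yA1.
exists y; last by rewrite !inE yA (negbTE yA1).
rewrite !inE yA (negbTE yA1) /=; apply/bigcupP; exists x => //.
by rewrite !inE yb yA1.
Qed.

(** Union bound: every member contains some [t]-subset of [M]. *)
Lemma cover_card_le (V : finType) (F : {set {set V}}) (M : {set V}) (t b : nat) :
  (forall A, A \in F -> t <= #|A :&: M|) ->
  (forall T : {set V}, #|T| = t -> #|[set A in F | T \subset A]| <= b) ->
  #|F| <= 'C(#|M|, t) * b.
Proof.
move=> FM Fb; rewrite -cards_draws -sum_nat_const.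
apply: (@leq_trans #|\bigcup_(T in [set T : {set V} | T \subset M & #|T| == t])
                       [set A in F | T \subset A]|).
  apply/subset_leq_card/subsetP => A AF.
  have : 0 < #|[set T : {set V} | T \subset A :&: M & #|T| == t]|.
    by rewrite cards_draws bin_gt0 FM.
  case/card_gt0P => T; rewrite !inE subsetI => /andP[/andP[TA TM] Tt].
  by apply/bigcupP; exists T; rewrite !inE ?TM ?AF.
elim/big_ind2: _ => [|m A n B mA nB|T]; first by rewrite cards0.
  by rewrite (leq_trans (leq_card_setU _ _)) // leq_add.
by rewrite inE => /andP[_ /eqP]; apply: Fb.
Qed.

(** For [j = s - i > 0], absorption gives [N * 'C(N.-1, j.-1) = j * 'C(N, j)], and [j <= s];
    otherwise the left side is zero. *)
Lemma leq_mul_binz_pred N s i : 0 < s ->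
  N * binz N.-1 (s.-1%:Z - i%:Z)%R <= s * binz N (s%:Z - i%:Z)%R.
Proof.
move=> s0; rewrite !binzB; case: (leqP i s.-1) => is_; last by rewrite muln0.
rewrite mul_bin_diag (_ : (s.-1 - i).+1 = s - i); last by lia.
by rewrite ifT ?leq_mul2r ?leq_subr ?orbT //; lia.
Qed.

(** * The dichotomy on a common [l1]-subset *)

Lemma exists_subset_card (V : finType) (A : {set V}) l :
  l <= #|A| -> exists2 T : {set V}, T \subset A & #|T| = l.
Proof.
rewrite -bin_gt0 -cards_draws => /card_gt0P[T].
by rewrite inE => /andP[TA /eqP Tl]; exists T.
Qed.

Theorem theorem1p7 (s r n : nat) (L : s.-tuple nat) (K : r.-tuple nat)
    (F : {set {set 'I_n}}) :
  let l1 := nth 0 L 0 in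
  let k := max_member_size F in
  let bound := \sum_(i < r) binz (n - l1) (s%:Z - i%:Z)%R in
  0 < s ->
  sorted ltn L ->
  uniq K ->
  (forall x, x \in K -> 0 < x) ->
  (forall x, x \in K -> (s%:Z - r%:Z + l1%:Z < x%:Z)%R) ->
  (forall A, A \in F -> #|A| \in K) ->
  (forall A B, A \in F -> B \in F -> A != B -> #|A :&: B| \in L) ->
  'C(k ^ 2, l1.+1) * s + l1 <= n ->
  #|F| <= bound /\
  ('C(k ^ 2, l1.+1) * s + l1 < n -> #|F| = bound ->
   exists T : {set 'I_n}, #|T| = l1 /\ (forall A, A \in F -> T \subset A)).
Proof.
move=> l1 k bound s0 sortL _ _ Kbig FK FL nbig.
have Kbig' x : x \in K -> s + l1 < x + r by move=> /Kbig; lia.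
have [[T Tl TF]|noT] : (exists2 T : {set 'I_n}, #|T| = l1 & forall A, A \in F -> T \subset A) \/
    forall T : {set 'I_n}, #|T| = l1 -> exists2 A, A \in F & ~~ (T \subset A).
  case: (boolP [exists T : {set 'I_n}, (#|T| == l1) && [forall A in F, T \subset A]]).
    by move=> /existsP[T /andP[/eqP Tl /forall_inP TF]]; left; exists T.
  move=> /existsPn h; right => T Tl; have := h T.
  by rewrite Tl eqxx /= => /forall_inPn[A AF AT]; exists A.
  split=> [|_ _]; last by exists T.
  rewrite /bound -[n in n - l1]card_ord -Tl.
  by apply: (@alon_babai_suzuki_link _ T s r L K); rewrite ?size_tuple ?Tl.
(* Without a common [l1]-set the inequality is strict for large [n], so equality cannot occur. *)
suff [le lt] : #|F| <= bound /\ ('C(k ^ 2, l1.+1) * s + l1 < n -> #|F| < bound).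
  by split=> // /lt + E; rewrite E ltnn.
have l1n : l1 <= n by apply: leq_trans nbig; rewrite leq_addl.
(* A single member must have fewer than [l1] points, which forces [s < r]; the terms [i = s] and
   [i = s.-1] then already sum to [(n - l1).+1]. *)
have [Fle1|F1] := leqP #|F| 1.
  have [T _ Tl] : exists2 T : {set 'I_n}, T \subset setT & #|T| = l1.
    by apply: exists_subset_card; rewrite cardsT card_ord.
  have [A AF _] := noT T Tl.
  have Al1 : #|A| < l1.
    rewrite ltnNge; apply/negP => /exists_subset_card[T' T'A T'l].
    have [B BF] := noT T' T'l.
    by rewrite (card_le1_eqP Fle1 A B AF BF) T'A.
  have sr : s < r by have := Kbig' _ (FK _ AF); lia.
  have s1r : s.-1 < r by lia.
  have : (n - l1).+1 <= bound.
    rewrite /bound (bigD1 (Ordinal sr)) // (bigD1 (Ordinal s1r)) /=; last first.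
      by rewrite -val_eqE /=; lia.
    rewrite !binzB leqnn subnn bin0 leq_pred (_ : s - s.-1 = 1); last by lia.
    by rewrite bin1; lia.
  by split; lia.
have Lhead l : l \in tval L -> l1 <= l /\ (l1 < l -> l \in behead L).
  rewrite /l1; case: (tval L) sortL => [//|x L' /= xL'].
  rewrite inE => /predU1P[->|lL']; first by rewrite ltnn.
  by have /allP/(_ l lL')/ltnW := order_path_min ltn_trans xL'.
have [M Mk FM] : exists2 M : {set 'I_n}, #|M| <= k ^ 2 & forall A, A \in F -> l1 < #|A :&: M|.
  apply: small_cover noT => // [A AF|A B AF BF AB].
    by rewrite /k /max_member_size (bigD1 A) //= leq_maxl.
  by have [] := Lhead _ (FL _ _ AF BF AB).
pose D := \sum_(i < r) binz (n - l1).-1 (s.-1%:Z - i%:Z)%R.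
have FD : #|F| <= 'C(k ^ 2, l1.+1) * D.
  apply: (@leq_trans ('C(#|M|, l1.+1) * D)); last by rewrite leq_mul2r leq_bin2l ?orbT.
  apply: cover_card_le FM _ => T Tl.
  rewrite /D -subnS -[n in n - _]card_ord -Tl.
  (* Since [s.-1 + l1.+1 = s + l1], losing the value [l1] pays for the extra point of [T] in the
     condition on [K]. *)
  apply: (@alon_babai_suzuki_link _ T s.-1 r (behead L) K).
  - by rewrite size_behead size_tuple.
  - by rewrite size_tuple.
  - by move=> x /Kbig'; rewrite Tl; lia.
  - by move=> A; rewrite inE => /andP[].
  - by move=> A; rewrite inE => /andP[/FK].
  move=> A B; rewrite !inE => /andP[AF TA] /andP[BF TB] AB.
  have [_] := Lhead _ (FL _ _ AF BF AB); apply.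
  by rewrite -Tl subset_leq_card // subsetI TA.
have Db : (n - l1) * D <= s * bound.
  rewrite /D /bound !big_distrr; apply: leq_sum => i _; exact: leq_mul_binz_pred.
have D0 : 0 < D by rewrite lt0n; apply: contraTneq F1 => D0; rewrite D0 muln0 in FD; lia.
have FsD : #|F| * s <= 'C(k ^ 2, l1.+1) * s * D by rewrite mulnAC leq_mul2r FD orbT.
(* Both parts use [#|F| * s <= 'C(k ^ 2, l1.+1) * s * D <= (n - l1) * D <= s * bound]; the middle
   step is strict for larger [n] because [D > 0]. *)
split=> [|nlt].
  rewrite -(leq_pmul2l s0) mulnC (leq_trans FsD) // (leq_trans _ Db) //.
  by rewrite leq_mul2r; apply/orP; right; lia.
rewrite -(ltn_pmul2l s0) mulnC (leq_ltn_trans FsD) // (leq_trans _ Db) //.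
by rewrite ltn_pmul2r //; lia.
Qed.
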